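(* Let $E\in\mathcal M(I_0,\{n_k\},\{c_k\})$ be a homogeneous Moran set. Suppose there are two nonnegative real sequences $\{L_k\}_{k\ge1}$ and $\{R_k\}_{k\ge1}$ such that $\xi_{\sigma,0}=L_{k+1}$ and $\xi_{\sigma,n_{k+1}}=R_{k+1}$ for all $k\ge0$ and all $\sigma\in D_k$. Assume moreover that there are constants $w_1,w_2,w_3>0$, independent of $k$, such that for any $k\ge1$ at least one of the following three conditions holds: (A) $\overline\nu_k\le w_1\delta_k$; (B) $\overline\nu_k\le w_2\,\underline\nu_k$; (C) $n_k\underline\nu_k\ge w_3\delta_{k-1}$. Then $$\dim_P E=\overline{\dim}_B E=\limsup_{k\to\infty}\frac{\log (n_1n_2\cdots n_kn_{k+1})}{-\log(\delta_k-L_{k+1}-R_{k+1})+\log n_{k+1}}.$$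
   Context: $\dim_P$ is packing dimension and $\overline{\dim}_B$ is upper box dimension. $|A|$ denotes the diameter of $A\subset\mathbb R$. Homogeneous Moran sets. Let $\{n_k\}_{k\ge1}$ be integers with $n_k\ge2$ and $\{c_k\}_{k\ge1}$ positive reals with $n_kc_k<1$. Let $D_k=\{i_1\cdots i_k:1\le i_j\le n_j,\ 1\le j\le k\}$ for $k\ge1$, let $D_0$ consist of the empty word $\emptyset$ only, and $D=\bigcup_{k\ge0}D_k$; $\sigma*l$ denotes concatenation. Let $I_0=[0,1]$. A family $\{I_\sigma:\sigma\in D\}$ of closed subintervals of $I_0$ has homogeneous Moran structure if: (1) $I_\emptyset=I_0$; (2) for $k\ge1$, $\sigma\in D_{k-1}$, the intervals $I_{\sigma*1},\dots,I_{\sigma*n_k}$ are closed subintervals of $I_\sigma$ with $\min I_{\sigma*(l+1)}\ge\max I_{\sigma*l}$ for $1\le l\le n_k-1$; (3) $|I_{\sigma*i}|/|I_\sigma|=c_k$ for all $k\ge1$, $\sigma\in D_{k-1}$, $1\le i\le n_k$. Then $E=\bigcap_{k\ge0}\bigcup_{\sigma\in D_k}I_\sigma$ is called a homogeneous Moran set, and $\mathcal M(I_0,\{n_k\},\{c_k\})$ is the class of all such sets (each considered together with its family of intervals). Notation. For $k\ge1$, $\sigma\in D_{k-1}$, $1\le i\le n_k-1$: $\xi_{\sigma,0}=\min I_{\sigma*1}-\min I_\sigma$, $\xi_{\sigma,i}=\min I_{\sigma*(i+1)}-\max I_{\sigma*i}$, $\xi_{\sigma,n_k}=\max I_\sigma-\max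 I_{\sigma*n_k}$. Further $\overline\nu_k=\max_{\sigma\in D_{k-1},1\le i\le n_k-1}\xi_{\sigma,i}$, $\underline\nu_k=\min_{\sigma\in D_{k-1},1\le i\le n_k-1}\xi_{\sigma,i}$, and $\delta_k=\prod_{i=1}^kc_i$ (with $\delta_0=1$), the common length of the $I_\sigma$, $\sigma\in D_k$. *)

(* Defs.v *)
From HB Require Import structures.
From mathcomp Require Export all_boot all_order all_algebra.
From mathcomp Require Export all_classical all_reals all_analysis.
Export Order.TTheory GRing.Theory Num.Theory.
Export numFieldNormedType.Exports.

Set Implicit Arguments.
Unset Strict Implicit.
Unset Printing Implicit Defensive.

Local Open Scope classical_set_scope.
Local Open Scope ring_scope.

Definition diam (R : realType) (A : set R) : \bar R :=
  ereal_sup [set `|p.1 - p.2|%:E | p in A `*` A].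

(* Least number of sets of diameter at most [d] covering [A]; [+oo] when there
   is no finite cover. *)
Definition covering_number (R : realType) (A : set R) (d : R) : \bar R :=
  ereal_inf [set (m%:R)%:E | m in [set m : nat | exists U : 'I_m -> set R,
    (forall i, (diam (U i) <= d%:E)%E) /\ A `<=` \bigcup_i U i]].

Definition upper_box_dim (R : realType) (A : set R) : \bar R :=
  limf_esup (fun d : R => (lne (covering_number A d) / (- ln d)%:E)%E) 0^'+.

(* [d]-packings of [A]: countable disjoint families of closed balls centred in
   [A] with radii at most [d].  The family is indexed by an arbitrary [D], a
   subset of [nat], so that finite and empty families are included; [2 * r i] is
   the diameter of the [i]-th ball. *)
Definition packing_delta (R : realType) (s : R) (A : set R) (d : R) : \bar R :=
  ereal_sup [set x | exists (D : set nat) (a r : nat -> R),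
    [/\ forall i, D i -> A (a i) /\ 0 < r i <= d,
        trivIset D (fun i => closed_ball (a i) (r i))
      & x = (\esum_(i in D) ((2 * r i) `^ s)%:E)%E]].

Definition packing_premeasure (R : realType) (s : R) (A : set R) : \bar R :=
  lim (packing_delta s A d @[d --> 0^'+]).

Definition packing_measure (R : realType) (s : R) (A : set R) : \bar R :=
  ereal_inf [set (\sum_(i <oo) packing_premeasure s (F i))%E |
    F in [set F : nat -> set R | A `<=` \bigcup_i F i]].

Definition packing_dim (R : realType) (A : set R) : \bar R :=
  ereal_inf [set s%:E | s in
    [set s : R | 0 <= s /\ packing_measure s A = 0%E]].

(* The sequences [n] and [c] are indexed from 1: their values at 0 are never
   used.  Likewise the letters of a word start from 1, and the [j]-th letter
   (1 <= j) is [nth 0 s j.-1]. *)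
Definition words (n : nat -> nat) (k : nat) : set (seq nat) :=
  [set s | size s = k /\
    forall j, (1 <= j <= k)%N -> (1 <= nth 0%N s j.-1 <= n j)%N].

(* The interval of the word [s] is [lo s, hi s]; the values of [lo] and [hi] at
   sequences that are not words are irrelevant. *)
Definition word_itv (R : realType) (lo hi : seq nat -> R) (s : seq nat) :
    set R :=
  `[lo s, hi s].

Definition homogeneous_moran_structure (R : realType)
    (n : nat -> nat) (c : nat -> R) (lo hi : seq nat -> R) : Prop :=
  [/\ forall k s, words n k s -> lo s <= hi s,
      lo [::] = 0 /\ hi [::] = 1,
      forall k s, (1 <= k)%N -> words n k.-1 s ->
        (forall i, (1 <= i <= n k)%N ->
           word_itv lo hi (rcons s i) `<=` word_itv lo hi s) /\
        (forall l, (1 <= l <= (n k).-1)%N ->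
           hi (rcons s l) <= lo (rcons s l.+1))
    & forall k s i, (1 <= k)%N -> words n k.-1 s -> (1 <= i <= n k)%N ->
        (hi (rcons s i) - lo (rcons s i)) / (hi s - lo s) = c k].

Definition moran_set (R : realType) (n : nat -> nat) (lo hi : seq nat -> R) :
    set R :=
  \bigcap_(k in [set: nat]) \bigcup_(s in words n k) word_itv lo hi s.

(* [n (size s).+1] is the number of children of the word [s]. *)
Definition gap (R : realType) (n : nat -> nat) (lo hi : seq nat -> R)
    (s : seq nat) (i : nat) : R :=
  if i == 0%N then lo (rcons s 1%N) - lo s
  else if i == n (size s).+1 then hi s - hi (rcons s i)
  else lo (rcons s i.+1) - hi (rcons s i).

Definition inner_gaps (R : realType) (n : nat -> nat) (lo hi : seq nat -> R)
    (k : nat) : set R :=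
  [set x | exists s i,
    [/\ words n k.-1 s, (1 <= i <= (n k).-1)%N & x = gap n lo hi s i]].

(* For 1 <= k and 2 <= n k the set of inner gaps is finite and nonempty, so that
   the supremum and the infimum are a maximum and a minimum. *)
Definition max_gap (R : realType) (n : nat -> nat) (lo hi : seq nat -> R)
    (k : nat) : R :=
  sup (inner_gaps n lo hi k).

Definition min_gap (R : realType) (n : nat -> nat) (lo hi : seq nat -> R)
    (k : nat) : R :=
  inf (inner_gaps n lo hi k).

Definition level_length (R : realType) (c : nat -> R) (k : nat) : R :=
  \prod_(1 <= i < k.+1) c i.

(* Main.v *)
Require Import Defs.
From mathcomp Require Import ring lra zify.

(* Write d_k = delta_k - L_{k+1} - R_{k+1}, e_k = d_k / n_{k+1} and
   N_k = n_1 ... n_k.  The set is covered by N_k intervals of length d_k, and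
   cutting each of them into pieces of length e (e_k <= e <= d_k) bounds the
   covering number at every scale, so the upper box dimension is at most the
   limsup S of log N_{k+1} / - log e_k.  Since the packing dimension never
   exceeds the upper box dimension, it remains to bound it below by S.  Given a
   countable cover of the set, Baire's theorem yields a member F of the cover
   that meets every basic interval below some word.  Among the intervals of
   level k + 1, those whose last letter is even are separated by delta_{k+1}
   plus the least inner gap, which each of (A), (B), (C) bounds below by a fixed
   multiple of e_k.  Balls of radius comparable to e_k centred in F thus form
   packings with about N_{k+1} members, whose t-weight is unbounded as soon as
   t < S. *)
Set Implicit Arguments.
Unset Strict Implicit.
Unset Printing Implicit Defensive.

Local Open Scope classical_set_scope.
Local Open Scope ring_scope.

(** * Upper limits along a filter *)

Section UpperLimit.
Variables (R : realType) (X : choiceType) (T : filteredType X).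
Implicit Types (f : T -> \bar R) (F : set (set T)) (V : set T).

Lemma limf_esup_lt f F (t : \bar R) : (limf_esup f F < t)%E ->
  exists2 V, F V & forall x, V x -> (f x < t)%E.
Proof.
case/ereal_inf_lt => _ [V FV <-] Vt; exists V => // x Vx.
by apply: le_lt_trans Vt; apply: ereal_sup_ubound; exists x.
Qed.

Lemma limf_esup_le f F V (t : \bar R) :
  F V -> (forall x, V x -> (f x <= t)%E) -> (limf_esup f F <= t)%E.
Proof.
move=> FV Vt; apply: (@le_trans _ _ (ereal_sup (f @` V))).
  by apply: ereal_inf_lbound; exists V.
by apply: ge_ereal_sup => _ [x Vx <-]; exact: Vt.
Qed.

Lemma lt_limf_esup f F V (t : \bar R) :
  (t < limf_esup f F)%E -> F V -> exists2 x, V x & (t < f x)%E.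
Proof.
move=> tf FV.
have /ereal_sup_gt [_ [x Vx <-] tx] : (t < ereal_sup (f @` V))%E.
  by apply: lt_le_trans tf _; apply: ereal_inf_lbound; exists V.
by exists x.
Qed.

End UpperLimit.

(** * Extended reals, right neighbourhoods of zero and real powers *)

Section Reals.
Variable R : realType.
Implicit Types (x y : \bar R) (d t : R).

(** Lets a bound [y] that may be infinite be tested at the real exponents above it. *)
Lemma lee_gt_fin x y :
  (forall t, (y < t%:E)%E -> (x <= t%:E)%E) -> (x <= y)%E.
Proof.
case: y => [r||] H; last 2 first.
- exact: leey.
- case: x H => [r||] H //.
    have := H (r - 1 : R); rewrite ltNyr lee_fin => /(_ isT) h; exfalso; lra.
  by have := H 0; rewrite ltNyr => /(_ isT).
apply/lee_addgt0Pr => e e0; rewrite -EFinD; apply: H.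
by rewrite lte_fin ltrDl.
Qed.

Lemma at_right0P (V : set R) : (0 : R)^'+ V ->
  exists2 e : R, 0 < e & forall d, 0 < d -> d < e -> V d.
Proof.
case/nbhs_ballP => e /= e0 He; exists e => // d d0 de.
by apply: He => //=; rewrite /ball/= sub0r normrN gtr0_norm.
Qed.

Lemma at_right0_itv (e : R) : 0 < e -> (0 : R)^'+ [set d | 0 < d < e].
Proof.
move=> e0; near=> d; apply/andP; split; near: d.
  exact: nbhs_right_gt.
exact: nbhs_right_lt.
Unshelve. all: end_near. Qed.

Lemma powR_exp (a : R) t : 0 < a -> a `^ t = expR (t * ln a).
Proof. by move=> a0; rewrite /powR gt_eqF. Qed.

(** When [y] is an upper limit of exponents, the margin [e] is the surplus that makes the weights of
    packings blow up. *)
Lemma lte_fin_margin t y :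
  (t%:E < y)%E -> exists2 e : R, 0 < e & ((t + e)%:E < y)%E.
Proof.
move=> ty; apply: contrapT => H; move: ty; apply/negP; rewrite -leNgt.
apply/lee_addgt0Pr => e e0; rewrite -EFinD leNgt; apply/negP => te.
by apply: H; exists e.
Qed.

Lemma ler_powRl (a b : R) t : 0 <= t -> 0 <= a -> a <= b -> a `^ t <= b `^ t.
Proof.
by move=> t0 a0 ab; apply: ge0_ler_powR; rewrite ?nnegrE// (le_trans a0).
Qed.

End Reals.

(** * Covering numbers and upper box dimension *)

Section Dimensions.
Variable R : realType.
Implicit Types (A : set R) (d t e : R).

Lemma covering_number_ge0 A d : (0 <= covering_number A d)%E.
Proof.
by apply: le_ereal_inf_tmp => _ [m _ <-]; rewrite lee_fin ler0n.
Qed.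

Lemma covering_number_le A d (l : seq R) :
  (forall x, A x -> exists2 y, y \in l & y <= x <= y + d) ->
  (covering_number A d <= (size l)%:R%:E)%E.
Proof.
move=> H; apply: ereal_inf_lbound; exists (size l) => //.
exists (fun i : 'I_(size l) => `[nth 0 l i, nth 0 l i + d]%classic); split.
  move=> i; apply: ge_ereal_sup => _ [[x y] [/= xi yi] <-].
  rewrite lee_fin; move: xi yi; rewrite /= !in_itv/= => /andP[? ?] /andP[? ?].
  by rewrite ler_norml; apply/andP; split; lra.
move=> x /H[y yl xy].
have il : (index y l < size l)%N by rewrite index_mem.
by exists (Ordinal il) => //=; rewrite in_itv/= nth_index.
Qed.

Lemma covering_number_lt A d (M : R) : (covering_number A d < M%:E)%E ->
  exists m : nat, m%:R < M /\ exists U : 'I_m -> set R,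
    (forall i, (diam (U i) <= d%:E)%E) /\ A `<=` \bigcup_i U i.
Proof.
by case/ereal_inf_lt => _ [m mU <-]; rewrite lte_fin => mM; exists m.
Qed.

Lemma upper_box_dim_ge0 A : A !=set0 -> (0 <= upper_box_dim A)%E.
Proof.
case=> a Aa; rewrite leNgt; apply/negP => /limf_esup_lt[V FV Vlt].
have [d [Vd /andP[d0 d1]]] := filter_ex (filterI FV (at_right0_itv (@ltr01 R))).
have := Vlt d Vd; apply/negP; rewrite -leNgt; apply: mule_ge0.
  rewrite lne_ge0; apply: le_ereal_inf_tmp => _ [m [U [_ AU]] <-].
  rewrite lee_fin ler1n; have [i _ _] := AU _ Aa.
  exact: leq_ltn_trans (ltn_ord i).
by rewrite inve_ge0 lee_fin oppr_ge0 ln_le0 ?ltW.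
Qed.

(** The constant [C] adds only [ln C / - ln d] to the quotient of logarithms, and this tends to 0
    with [d]. *)
Lemma upper_box_dim_le A t (C d0 : R) : 0 < C -> 0 < d0 ->
  (forall d, 0 < d -> d < d0 -> (covering_number A d <= (C * d `^ (- t))%:E)%E) ->
  (upper_box_dim A <= t%:E)%E.
Proof.
move=> C0 d00 H; apply/lee_addgt0Pr => e e0.
pose D := Num.min d0 (Num.min 1 (expR (- ln C / e))).
have D0 : 0 < D by rewrite !lt_min d00 ltr01 expR_gt0.
apply: (limf_esup_le (at_right0_itv D0)) => d /= /andP[dp].
rewrite !lt_min => /and3P[dd0 d1 dC].
have lnd : 0 < - ln d by rewrite oppr_gt0 ln_lt0// dp.
have lnC : ln C <= e * - ln d.
  move: dC; rewrite -[X in X < _]lnK ?posrE// ltr_expR.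
  by rewrite ltr_pdivlMr// mulrC => ?; lra.
have dt0 : 0 < C * d `^ (- t) by rewrite mulr_gt0// powR_gt0.
apply: (@le_trans _ _ ((ln (C * d `^ (- t)))%:E / (- ln d)%:E)%E).
  apply: lee_wpmul2r; first by rewrite inve_ge0 lee_fin ltW.
  rewrite -lne_EFin// lee_lne ?H//.
    by rewrite in_itv/= covering_number_ge0 leey.
  by rewrite in_itv/= leey andbT lee_fin ltW.
rewrite inver gt_eqF// -EFinM -EFinD lee_fin ler_pdivrMr//.
by rewrite lnM ?posrE// ?powR_gt0// ln_powR; lra.
Qed.

Lemma covering_number_lt_powR A t : (upper_box_dim A < t%:E)%E ->
  exists e : R, [/\ 0 < e, e <= 1 & forall d, 0 < d -> d < e ->
    (covering_number A d < (d `^ (- t))%:E)%E].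
Proof.
case/limf_esup_lt => V /at_right0P[e e0 Ve] Vlt.
exists (Num.min e 1); split; first by rewrite lt_min e0 ltr01.
  by rewrite ge_min lexx orbT.
move=> d d0; rewrite lt_min => /andP[de d1].
have lnd : 0 < - ln d by rewrite oppr_gt0 ln_lt0// d0.
have := Vlt d (Ve d d0 de); rewrite inver gt_eqF//.
case: (covering_number A d) => [r||] //=; last by rewrite ltNyr.
  case: ifPn => [r0 _|]; first by rewrite lte_fin (le_lt_trans r0)// powR_gt0.
  rewrite -ltNge => r0; rewrite -EFinM !lte_fin ltr_pdivrMr//.
  by move=> rt; rewrite -ltr_ln ?posrE ?powR_gt0// ln_powR mulNr -mulrN.
by rewrite gt0_mulye// lte_fin invr_gt0.
Qed.

(** Pigeonhole: two of the points in the same [U k] would be at distance at most [d]. *)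
Lemma size_separated_le A d (m : nat) (U : 'I_m -> set R) (l : seq nat)
    (a : nat -> R) :
  (forall i, (diam (U i) <= d%:E)%E) -> A `<=` \bigcup_i U i -> uniq l ->
  (forall i, i \in l -> A (a i)) ->
  {in l &, forall i j, i != j -> d < `|a i - a j|} -> (size l <= m)%N.
Proof.
move=> Ud AU ul Al sep.
have [g gP] : {g : nat -> nat & forall i, i \in l ->
    exists2 k : 'I_m, g i = k & U k (a i)}.
  apply: (@choice _ _ (fun i (k : nat) => i \in l ->
    exists2 k' : 'I_m, k = k' & U k' (a i))).
  move=> i; have [il|nil] := boolP (i \in l); last by exists 0%N.
  by have [k _ Uk] := AU _ (Al i il); exists k => _; exists k.
rewrite -(size_map g) -(size_iota 0 m); apply: uniq_leq_size.
  rewrite map_inj_in_uniq// => i j il jl gij; apply/eqP/negPn/negP => ij.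
  have [k gik Uki] := gP i il; have [k' gjk Ukj] := gP j jl.
  have kk' : k = k' by apply: val_inj; rewrite /= -gik -gjk.
  have := sep i j il jl ij; apply/negP; rewrite -leNgt -lee_fin.
  apply: le_trans (Ud k); apply: ereal_sup_ubound.
  by exists (a i, a j) => //; split => //=; rewrite kk'.
move=> _ /mapP[i il ->]; have [k -> _] := gP i il.
by rewrite mem_iota /= add0n ltn_ord.
Qed.

(* The balls whose radius lies between two consecutive powers of [1 / e] are
   counted by the covering number at the smaller scale; the resulting series
   is geometric. *)
Lemma packing_sum_bounded A s t : (upper_box_dim A < s%:E)%E -> s < t ->
    0 <= t ->
  exists C e : R, [/\ 0 <= C, 0 < e & forall (l : seq nat) (a r : nat -> R),
    uniq l -> (forall i, i \in l -> A (a i) /\ 0 < r i <= e) ->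
    {in l &, forall i j, i != j -> r i <= `|a i - a j|} ->
    \sum_(i <- l) (2 * r i) `^ t <= C].
Proof.
move=> /covering_number_lt_powR[e [e0 e1 cov]] st t0.
pose h (m : nat) : R := expR (- m%:R).
pose x := expR (s - t).
have x1 : x < 1 by rewrite expR_lt1 subr_lt0.
have x0 : 0 < x by rewrite expR_gt0.
pose c : R := 2 `^ t * expR s.
have c0 : 0 < c by rewrite mulr_gt0 ?expR_gt0// powR_gt0.
exists (c / (1 - x)), e; split => //.
  by rewrite divr_ge0 ?subr_ge0 ?ltW.
move=> l a r ul Alr sep.
(* [k i] is the m with [h m.+1 < r i <= h m]; [p i] is the same number in a finite type, over which
   the sum is partitioned. *)
pose k i := Num.truncn (- ln (r i)).
pose M := \max_(i <- l) k i.
pose p i : 'I_M.+1 := inord (k i).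
have hr i : i \in l -> h (p i).+1 < r i <= h (p i).
  move=> il; have [_ /andP[r0 re]] := Alr i il.
  have lnr : 0 <= - ln (r i) by rewrite oppr_ge0 ln_le0// (le_trans re).
  have -> : p i = k i :> nat by rewrite /p inordK// ltnS; exact: leq_bigmax_seq.
  have /andP[k1 k2] := truncn_itv lnr.
  rewrite /h -[X in _ < X <= _](@lnK R) ?posrE// ltr_expR ler_expR.
  by rewrite ltrNl k2 lerNr k1.
(* The left side bounds the number of balls in class m times the weight of one ball; [x < 1] because
   [s < t]. *)
have hE m : (h m.+1) `^ (- s) * (2 * h m) `^ t = c * x ^+ m.
  rewrite powRM ?ler0n ?ltW ?expR_gt0// /c /x /h -!expRM -expRM_natl.
  rewrite mulrCA -!mulrA; congr (_ * _); rewrite -!expRD; congr expR.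
  by rewrite -natr1; ring.
have cnt (m : 'I_M.+1) :
    \sum_(i <- l | (i \in l) && (p i == m)) (2 * r i) `^ t <= c * x ^+ m.
  rewrite -big_filter; set l' := [seq i <- l | _].
  have l'P i : i \in l' -> i \in l /\ h m.+1 < r i <= h m.
    by rewrite mem_filter => /andP[/andP[il /eqP <-] _]; split => //; exact: hr.
  have [->|[i0 i0l']] : l' = [::] \/ exists i, i \in l'.
  - by case: (l') => [|i ?]; [left|right; exists i; rewrite mem_head].
  - by rewrite big_nil mulr_ge0 ?exprn_ge0 ?ltW.
  have he : h m.+1 < e.
    have [il /andP[hr0 _]] := l'P _ i0l'; have [_ /andP[_ re]] := Alr _ il.
    exact: lt_le_trans re.
  have [q [qM [U [Ud AU]]]] := covering_number_lt (cov _ (expR_gt0 _) he).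
  have sq : (size l' <= q)%N.
    apply: (size_separated_le (a := a) Ud AU); first exact: filter_uniq.
      by move=> i /l'P[/Alr[Aa _] _].
    move=> i j /l'P[il /andP[hi _]] /l'P[jl _] ij.
    exact: lt_le_trans (sep _ _ il jl ij).
  apply: (@le_trans _ _ (\sum_(i <- l') (2 * h m) `^ t)).
    rewrite big_seq [leRHS]big_seq; apply: ler_sum => i /l'P[il /andP[_ rh]].
    have [_ /andP[r0 _]] := Alr _ il.
    by apply: ler_powRl; rewrite ?ler_pM2l// mulr_ge0// ltW.
  rewrite big_const_seq count_predT iter_addr_0 -hE -[leLHS]mulr_natl.
  apply: ler_wpM2r; first exact: powR_ge0.
  by apply: ltW; apply: le_lt_trans qM; rewrite ler_nat.
rewrite big_seq (partition_big p predT)//=.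
apply: (@le_trans _ _ (\sum_(m < M.+1) c * x ^+ m)); first exact: ler_sum.
rewrite -(big_mkord predT (fun m => c * x ^+ m)).
by have := geometric_le_lim M.+1 (ltW c0) x0; rewrite gtr0_norm//; apply.
Qed.

End Dimensions.

(** * Packing premeasure, packing measure and packing dimension *)

Section Packing.
Variable R : realType.
Implicit Types (A : set R) (d t e : R).

Lemma packing_delta_ge0 t A d : (0 <= packing_delta t A d)%E.
Proof.
apply: ereal_sup_ubound; exists set0, (fun=> 0), (fun=> 0).
by split=> //; rewrite esum_set0.
Qed.

Lemma packing_delta_le t A (d d' : R) : d <= d' ->
  (packing_delta t A d <= packing_delta t A d')%E.
Proof.
move=> dd'; apply: le_ereal_sup => _ [D [a [r [Dar tD ->]]]].
exists D, a, r; split => // i /Dar[Aa /andP[r0 rd]].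
by rewrite r0 (le_trans rd dd').
Qed.

(** The limit is an infimum because a larger [d] admits more packings. *)
Lemma packing_premeasureE t A :
  packing_premeasure t A =
  ereal_inf [set packing_delta t A d | d in `]0, +oo[%classic].
Proof.
apply/cvg_lim; first exact: ereal_hausdorff.
apply: nondecreasing_at_right_cvge => // x y _ _; exact: packing_delta_le.
Qed.

Lemma packing_premeasure_ge0 t A : (0 <= packing_premeasure t A)%E.
Proof.
rewrite packing_premeasureE; apply: le_ereal_inf_tmp => _ [d _ <-].
exact: packing_delta_ge0.
Qed.

Lemma le_packing_premeasure t A (x : \bar R) :
  (forall d, 0 < d -> (x <= packing_delta t A d)%E) ->
  (x <= packing_premeasure t A)%E.
Proof.
move=> H; rewrite packing_premeasureE; apply: le_ereal_inf_tmp => _ [d d0 <-].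
by apply: H; move: d0; rewrite /= in_itv/= andbT.
Qed.

Lemma packing_premeasure_le t A d : 0 < d ->
  (packing_premeasure t A <= packing_delta t A d)%E.
Proof.
move=> d0; rewrite packing_premeasureE; apply: ereal_inf_lbound; exists d => //.
by rewrite /= in_itv/= d0.
Qed.

(** Of disjointness only this is kept: the centre [a j] is outside the open ball of radius [r i]
    around [a i]. Infinite packings are handled through their finite subsums. *)
Lemma packing_delta_le_sum t A d (C : R) :
  (forall (l : seq nat) (a r : nat -> R), uniq l ->
    (forall i, i \in l -> A (a i) /\ 0 < r i <= d) ->
    {in l &, forall i j, i != j -> r i <= `|a i - a j|} ->
    \sum_(i <- l) (2 * r i) `^ t <= C) ->
  (packing_delta t A d <= C%:E)%E.
Proof.
move=> H; apply: ge_ereal_sup => _ [D [a [r [Dar tD ->]]]].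
apply: ge_ereal_sup => _ [X [finX XD] <-].
rewrite fsbig_finite//= sumEFin lee_fin; apply: (H _ a r).
- exact: finmap.fset_uniq.
- by move=> i; rewrite in_fset_set// inE => /XD /Dar.
move=> i j; rewrite !in_fset_set// !inE => /XD Di /XD Dj ij.
rewrite leNgt; apply/negP => aij.
have [_ /andP[rj0 _]] := Dar j Dj.
have /trivIsetP/(_ i j Di Dj ij) := tD; apply/eqP/set0P.
exists (a j); split; apply: subset_closed_ball => //.
exact: ballxx.
Qed.

Lemma sum_le_packing_delta t A d (l : nat) (a r : nat -> R) :
  (forall i, (i < l)%N -> A (a i) /\ 0 < r i <= d) ->
  (forall i j, (i < l)%N -> (j < l)%N -> i != j ->
     r i + r j < `|a i - a j|) ->
  ((\sum_(i < l) (2 * r i) `^ t)%:E <= packing_delta t A d)%E.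
Proof.
move=> Aar sep; apply: ereal_sup_ubound; exists `I_l, a, r; split => //.
  apply/trivIsetP => i j /= il jl ij; apply/eqP/negPn/negP => /set0P[x []].
  have [_ /andP[ri _]] := Aar i il; have [_ /andP[rj _]] := Aar j jl.
  rewrite !closed_ball_itv//= !in_itv/= => /andP[? ?] /andP[? ?].
  have := sep i j il jl ij; apply/negP; rewrite -leNgt ler_norml.
  by apply/andP; split; lra.
rewrite esum_fset//; last by move=> i _; rewrite lee_fin powR_ge0.
by rewrite -fsbig_ord -sumEFin.
Qed.

(** For [u] strictly between [s] and [t] the sums with exponent [u] stay bounded, and exponent [t]
    brings an extra factor (2 r)^(t - u), which is small with the radii. *)
Lemma packing_premeasure_eq0 A s t :
    (upper_box_dim A < s%:E)%E -> s < t -> 0 <= s ->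
  packing_premeasure t A = 0%E.
Proof.
move=> As st s0; pose u := (s + t) / 2.
have su : s < u by rewrite /u; lra.
have ut : u < t by rewrite /u; lra.
have u0 : 0 <= u by lra.
have [C [e [C0 e0 bnd]]] := packing_sum_bounded As su u0.
apply/eqP; rewrite eq_le packing_premeasure_ge0 andbT.
apply/lee_addgt0Pr => z z0; rewrite add0e.
(* Chosen so that (2 d)^(t - u) <= z / (C + 1); the added 1 covers the case [C = 0]. *)
pose d := Num.min e ((z / (C + 1)) `^ (t - u)^-1 / 2).
have zC : 0 < z / (C + 1) by rewrite divr_gt0//; lra.
have d0 : 0 < d by rewrite lt_min e0 divr_gt0// powR_gt0.
apply: le_trans (packing_premeasure_le _ _ d0) _.
apply: packing_delta_le_sum => l a r ul Ar sep.
have tu0 : 0 <= t - u by lra.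
have bd : (2 * d) `^ (t - u) <= z / (C + 1).
  apply: (@le_trans _ _ (((z / (C + 1)) `^ (t - u)^-1) `^ (t - u))).
    apply: ler_powRl => //; first by rewrite mulr_ge0// ltW.
    by rewrite mulrC -ler_pdivlMr// ge_min lexx orbT.
  by rewrite -powRrM mulVf ?gt_eqF ?subr_gt0// powRr1// ltW.
apply: (@le_trans _ _ (\sum_(i <- l) (z / (C + 1)) * (2 * r i) `^ u)).
  rewrite big_seq [leRHS]big_seq; apply: ler_sum => i il.
  have [_ /andP[r0 rd]] := Ar i il.
  have -> : t = (t - u) + u by lra.
  rewrite powRD; last by apply/implyP => _; rewrite mulf_neq0// gt_eqF.
  apply: ler_wpM2r; first exact: powR_ge0.
  apply: le_trans bd; apply: ler_powRl => //; last by rewrite ler_pM2l.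
  by rewrite mulr_ge0// ltW.
have C1 : 0 < C + 1 by lra.
rewrite -[leRHS](divfK (lt0r_neq0 C1)) -mulr_sumr; apply: ler_wpM2l.
  exact: ltW.
apply: le_trans (bnd l a r ul _ sep) _; last lra.
move=> i /Ar[Aa /andP[r0 rd]]; split => //.
by rewrite r0 (le_trans rd)// ge_min lexx.
Qed.

Lemma packing_measure_ge0 t A : (0 <= packing_measure t A)%E.
Proof.
apply: le_ereal_inf_tmp => _ [F _ <-]; apply: nneseries_ge0 => i _ _.
exact: packing_premeasure_ge0.
Qed.

Lemma packing_dim_le_upper_box_dim A :
  A !=set0 -> (packing_dim A <= upper_box_dim A)%E.
Proof.
move=> A0; apply: lee_gt_fin => s As.
have s0 : 0 <= s by rewrite -lee_fin (le_trans (upper_box_dim_ge0 A0))// ltW.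
apply/lee_addgt0Pr => e e0; apply: ereal_inf_lbound; exists (s + e) => //.
split; first by rewrite addr_ge0// ltW.
apply/eqP; rewrite eq_le packing_measure_ge0 andbT.
apply: ereal_inf_lbound; exists (fun=> A); first by move=> x Ax; exists 0%N.
apply: eseries0 => // i _ _; apply: (packing_premeasure_eq0 As) => //.
by rewrite ltrDl.
Qed.

Lemma le_packing_dim A (x : \bar R) :
  (forall t, 0 <= t -> (t%:E < x)%E -> packing_measure t A != 0%E) ->
  (x <= packing_dim A)%E.
Proof.
move=> H; apply: le_ereal_inf_tmp => _ [t [t0 tA] <-].
by rewrite leNgt; apply/negP => /(H t t0)/eqP.
Qed.

Lemma packing_measure_neq0 t A :
  (forall F : nat -> set R, A `<=` \bigcup_i F i ->
    exists i, packing_premeasure t (F i) = +oo%E) ->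
  packing_measure t A != 0%E.
Proof.
move=> H; suff -> : packing_measure t A = +oo%E by [].
apply/eqP; rewrite -leye_eq; apply: le_ereal_inf_tmp => _ [F /H[i Fi] <-].
rewrite -Fi; have := nneseries_lim_ge (u_ := fun k => packing_premeasure t (F k)).
move=> /(_ xpredT 0%N i.+1) h; apply: le_trans (h _); last first.
  by move=> ? _ _; exact: packing_premeasure_ge0.
rewrite big_nat_recr//= leeDr// sume_ge0// => k _.
exact: packing_premeasure_ge0.
Qed.

End Packing.

(** * Finite words and their extensions *)

Section Words.
Variable n : nat -> nat.
Implicit Types (s w : seq nat) (i j k p : nat).

Lemma words_nil : words n 0 [::].
Proof. by split => // j; lia. Qed.

Lemma words_rcons k s i : words n k s -> (1 <= i <= n k.+1)%N ->
  words n k.+1 (rcons s i).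
Proof.
move=> [sk H] ik; split=> [|j jk]; first by rewrite size_rcons sk.
rewrite nth_rcons sk; have [jk'|kj] := ltnP j.-1 k; first by apply: H; lia.
by have -> : j = k.+1; [lia|rewrite eqxx].
Qed.

Lemma words_rconsP k s : words n k.+1 s ->
  exists w i, [/\ s = rcons w i, words n k w & (1 <= i <= n k.+1)%N].
Proof.
move=> [sk H]; case/lastP: s sk H => [|w i]//; rewrite size_rcons => -[wk] H.
exists w, i; split=> //.
  split=> // j jk; have := H j; rewrite nth_rcons wk.
  have -> : (j.-1 < k)%N by lia.
  by apply; lia.
by have := H k.+1; rewrite /= nth_rcons wk ltnn eqxx; apply; lia.
Qed.

Lemma words_take k s j : words n k s -> (j <= k)%N -> words n j (take j s).
Proof.
move=> [sk H] jk; split=> [|i ij]; first by rewrite size_takel ?sk.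
by rewrite nth_take; [apply: H|]; lia.
Qed.

Lemma take_rcons_words k s i j : words n k s -> (j <= k)%N ->
  take j (rcons s i) = take j s.
Proof. by move=> [sk _] jk; rewrite -cats1 takel_cat// sk. Qed.

(** The descendants of [s] lying [p] levels below it, as a list so that they can be counted. *)
Fixpoint extensions s p : seq (seq nat) :=
  if p is p'.+1 then
    [seq rcons w i | w <- extensions s p', i <- iota 1 (n (size s + p))]
  else [:: s].

Lemma extensions_uniq s p : uniq (extensions s p).
Proof.
elim: p => //= p IH; apply: allpairs_uniq => //; first exact: iota_uniq.
by move=> [w i] [w' i'] _ _ /= /rcons_inj[-> ->].
Qed.

Lemma extensionsP k s p w : words n k s -> w \in extensions s p ->
  words n (k + p) w /\ take k w = s.
Proof.
move=> ws; have sk := ws.1; elim: p w => [|p IH] w /=.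
  by rewrite inE addn0 => /eqP ->; split=> //; rewrite take_oversize// sk.
case/allpairsP => -[w' i] /= [/IH[ww' tw'] ii ->].
rewrite addnS (take_rcons_words _ ww') ?leq_addr//; split => //.
by apply: words_rcons => //; move: ii; rewrite mem_iota sk addnS add1n ltnS.
Qed.

Lemma words_extensions k w : words n k w -> w \in extensions [::] k.
Proof.
elim: k w => [|k IH] w; first by case=> /size0nil ->.
case/words_rconsP => w' [i [-> /IH ww' ik]] /=.
by apply/allpairsP; exists (w', i); rewrite mem_iota add0n add1n ltnS.
Qed.

Lemma size_extensions s p :
  (\prod_(1 <= i < (size s).+1) n i * size (extensions s p) =
   \prod_(1 <= i < (size s + p).+1) n i)%N.
Proof.
elim: p => [|p IH] /=; first by rewrite addn0 muln1.
rewrite size_allpairs size_iota mulnA IH addnS.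
by rewrite [in RHS]big_nat_recr.
Qed.

End Words.

(** * Nested intervals of a homogeneous Moran set *)

Section Moran.
Variables (R : realType) (n : nat -> nat) (c : nat -> R).
Variables (lo hi : seq nat -> R).
Hypothesis hn : forall k, (1 <= k)%N -> (2 <= n k)%N.
Hypothesis hc : forall k, (1 <= k)%N -> 0 < c k.
Hypothesis hnc : forall k, (1 <= k)%N -> (n k)%:R * c k < 1.
Hypothesis hmoran : homogeneous_moran_structure n c lo hi.

Implicit Types (s w : seq nat) (i j k p : nat) (x y : R).

Notation delta := (level_length c).
Local Definition branches k := (\prod_(1 <= i < k.+1) n i)%N.

Lemma level_lengthS k : delta k.+1 = delta k * c k.+1.
Proof. by rewrite /level_length big_nat_recr. Qed.

Lemma branchesS k : branches k.+1 = (branches k * n k.+1)%N.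
Proof. by rewrite /branches big_nat_recr. Qed.

Lemma level_length0 : delta 0 = 1.
Proof. by rewrite /level_length big_geq. Qed.

Lemma level_length_gt0 k : 0 < delta k.
Proof.
elim: k => [|k IH]; first by rewrite level_length0.
by rewrite level_lengthS mulr_gt0// hc.
Qed.

Lemma branches_gt0 k : (0 < branches k)%N.
Proof.
elim: k => [|k IH]; first by rewrite /branches big_geq.
by rewrite branchesS muln_gt0 IH (leq_trans _ (hn _)).
Qed.

Lemma branches_level_length k : (branches k)%:R * delta k <= 1.
Proof.
elim: k => [|k IH]; first by rewrite /branches big_geq// level_length0 mulr1.
rewrite branchesS level_lengthS natrM mulrACA.
have h : (n k.+1)%:R * c k.+1 <= 1 by rewrite ltW// hnc.
apply: le_trans IH; apply: ler_piMr => //.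
by rewrite mulr_ge0// ltW// level_length_gt0.
Qed.

(** Since n_k >= 2 and n_k c_k < 1, each level at least halves the length; the weaker harmonic decay
    is enough for convergence to 0. *)
Lemma level_length_le k : delta k <= (k.+1%:R)^-1.
Proof.
elim: k => [|k IH]; first by rewrite level_length0 invr1.
have c2 : c k.+1 * 2 <= 1.
  rewrite mulrC; apply: ltW; apply: le_lt_trans (hnc (ltn0Sn k)).
  by rewrite ler_pM2r ?hc// (ler_nat _ 2) hn.
have k0 : 0 < k.+1%:R :> R by rewrite ltr0n.
rewrite level_lengthS; apply: (@le_trans _ _ ((k.+1%:R)^-1 / 2)).
  apply: ler_pM => //; [exact/ltW/level_length_gt0|exact/ltW/hc|].
  by rewrite -[leRHS]mul1r ler_pdivlMr.
rewrite -invfM lef_pV2 ?posrE ?mulr_gt0// -natrM ler_nat; lia.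
Qed.

Lemma lo_le_hi k s : words n k s -> lo s <= hi s.
Proof. by case: hmoran => H _ _ _; exact: H. Qed.

Lemma child_sub k s i : words n k s -> (1 <= i <= n k.+1)%N ->
  lo s <= lo (rcons s i) /\ hi (rcons s i) <= hi s.
Proof.
move=> ws ik; have [_ _ /(_ k.+1 s isT ws)[/(_ i ik) H _] _] := hmoran.
have l := lo_le_hi (words_rcons ws ik); split.
  have := H (lo (rcons s i)); rewrite /word_itv /= !in_itv/= lexx l.
  by move=> /(_ isT) /andP[].
have := H (hi (rcons s i)); rewrite /word_itv /= !in_itv/= lexx l.
by move=> /(_ isT) /andP[].
Qed.

Lemma word_length k s : words n k s -> hi s - lo s = delta k.
Proof.
elim: k s => [|k IH] s.
  case=> /size0nil -> _; case: hmoran => _ [-> ->] _ _.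
  by rewrite level_length0 subr0.
case/words_rconsP => w [i [-> ww ik]].
have [_ _ _ /(_ k.+1 w i isT ww ik) H] := hmoran.
by rewrite level_lengthS -H (IH _ ww) mulrC divfK// gt_eqF// level_length_gt0.
Qed.

Lemma child_le k s i j : words n k s -> (1 <= i < j)%N -> (j <= n k.+1)%N ->
  hi (rcons s i) <= lo (rcons s j).
Proof.
move=> ws; have [_ _ /(_ k.+1 s isT ws)[_ H] _] := hmoran.
elim: j => [|j IH] ij jn; first lia.
have [->|ij'] : i = j \/ (i < j)%N by lia.
  by apply: H; rewrite /=; lia.
apply: (@le_trans _ _ (lo (rcons s j))); first by apply: IH; lia.
apply: (@le_trans _ _ (hi (rcons s j))); last by apply: H; rewrite /=; lia.
by apply: (@lo_le_hi k.+1); apply: words_rcons => //; lia.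
Qed.

(** Decided at the first letter where the words differ; deeper intervals stay inside the two
    children chosen there. *)
Lemma word_disjoint k s w : words n k s -> words n k w -> s != w ->
  hi s <= lo w \/ hi w <= lo s.
Proof.
elim: k s w => [|k IH] s w; first by case=> /size0nil -> _ [/size0nil ->].
case/words_rconsP => s' [i [-> ws ik]] /words_rconsP[w' [j [-> ww jk]]] sw.
have [ssw|/(IH _ _ ws ww)] := eqVneq s' w'.
  subst w'; have [ij|ji|ij] := ltngtP i j.
  - by left; apply: (child_le ws); lia.
  - by right; apply: (child_le ws); lia.
  - by move: sw; rewrite ij eqxx.
have [l1 h1] := child_sub ws ik; have [l2 h2] := child_sub ww jk.
by case=> h; [left|right]; lra.
Qed.

Lemma take_sub k s j : words n k s -> (j <= k)%N ->
  lo (take j s) <= lo s /\ hi s <= hi (take j s).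
Proof.
elim: k s => [|k IH] s ws jk.
  by have := ws.1 => /size0nil ->.
have [->|jk'] : j = k.+1 \/ (j <= k)%N by lia.
  by rewrite take_oversize// ws.1.
case/words_rconsP: ws => w [i [-> ww ik]].
rewrite (take_rcons_words _ ww)//.
have [? ?] := IH w ww jk'; have [? ?] := child_sub ww ik.
by split; lra.
Qed.

Lemma words_ones k : words n k (nseq k 1%N).
Proof.
split=> [|j jk]; first by rewrite size_nseq.
rewrite nth_nseq; have -> : (j.-1 < k)%N by lia.
by rewrite /= (leq_trans _ (hn _)); lia.
Qed.

Lemma moran_setP x k : moran_set n lo hi x ->
  exists s, words n k s /\ lo s <= x <= hi s.
Proof.
by move=> /(_ k I)[s ws]; rewrite /word_itv /= in_itv/= => h; exists s.
Qed.

(* Otherwise one could choose nested words, the [i]-th step avoiding [F i], and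
   their intervals would meet in a point of the set outside every [F i]. *)
Lemma moran_baire (F : nat -> set R) : moran_set n lo hi `<=` \bigcup_i F i ->
  exists i k s, words n k s /\ forall p w, words n p w -> (k <= p)%N ->
    take k w = s -> exists2 x, F i x & lo w <= x <= hi w.
Proof.
move=> EF; apply: contrapT => H.
(* [u] pairs an index with a word; the word gets a strictly longer extension whose interval misses
   the set of that index. *)
have next (u : nat * seq nat) : exists w, words n (size u.2) u.2 ->
    [/\ words n (size w) w, (size u.2 < size w)%N,
        take (size u.2) w = u.2 &
        forall x, F u.1 x -> ~ (lo w <= x <= hi w)].
  case: u => i s; have [ws|nws] := pselect (words n (size s) s); last first.
    by exists s.
  apply: contrapT => G; apply: H; exists i, (size s), s; split => // p w ww sp tw.
  apply: contrapT => G'; apply: G; exists (rcons w 1%N) => _.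
  have w1 : (1 <= 1 <= n p.+1)%N by rewrite /= (leq_trans _ (hn _)).
  rewrite !size_rcons ww.1; split.
  - exact: words_rcons.
  - by rewrite ltnS.
  - by rewrite (take_rcons_words _ ww).
  move=> x Fx /andP[x1 x2]; apply: G'; exists x => //.
  by have [? ?] := child_sub ww w1; apply/andP; split; lra.
have [f fP] := choice next.
pose sigma := fix sigma i := if i is i'.+1 then f (i', sigma i') else [::].
have ws i : words n (size (sigma i)) (sigma i).
  by elim: i => [|i /= IH]; [exact: words_nil|have [] := fP (i, sigma i) IH].
have sigmaS i : [/\ (size (sigma i) < size (sigma i.+1))%N,
    take (size (sigma i)) (sigma i.+1) = sigma i &
    forall x, F i x -> ~ (lo (sigma i.+1) <= x <= hi (sigma i.+1))].
  by have [] := fP (i, sigma i) (ws i).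
have size_sigma i : (i <= size (sigma i))%N.
  by elim: i => // i IH; have [? _ _] := sigmaS i; lia.
have nest i j : (i <= j)%N ->
    lo (sigma i) <= lo (sigma j) /\ hi (sigma j) <= hi (sigma i).
  elim: j => [|j IH] ij; first by have -> : i = 0%N by lia.
  have [->//|ij'] : i = j.+1 \/ (i <= j)%N by lia.
  have [h1 h2] := IH ij'; have [sj tj _] := sigmaS j.
  have := take_sub (ws j.+1) (ltnW sj); rewrite tj => -[? ?].
  by split; lra.
have lohi i j : lo (sigma i) <= hi (sigma j).
  have [h _] := nest i (maxn i j) (leq_maxl _ _).
  have [_ h'] := nest j (maxn i j) (leq_maxr _ _).
  have := lo_le_hi (ws (maxn i j)); lra.
pose X := [set lo (sigma i) | i in [set: nat]].
have x_in i : lo (sigma i) <= sup X <= hi (sigma i).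
  apply/andP; split.
    apply: ub_le_sup; last by exists i.
    by exists (hi (sigma 0%N)) => _ [j _ <-].
  by apply: ge_sup; [exists (lo (sigma 0%N)), 0%N|move=> _ [j _ <-]].
(* [sigma k] has length at least k, so its prefix of length k is a word of level k whose interval
   contains the limit point. *)
have /EF[i _ Fi] : moran_set n lo hi (sup X).
  move=> k _; exists (take k (sigma k)).
    exact: (words_take (ws k)).
  rewrite /word_itv /= in_itv/=; have := x_in k.
  have [? ?] := take_sub (ws k) (size_sigma k).
  by move=> /andP[? ?]; apply/andP; split; lra.
by have [_ _ /(_ _ Fi)] := sigmaS i; apply; exact: x_in.
Qed.

(** Otherwise empty sets would cover it, and [moran_baire] would give a point in one of them. *)
Lemma moran_nonempty : moran_set n lo hi !=set0.
Proof.
apply: contrapT => E0.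
have [x Ex|i [k [s [ws H]]]] := @moran_baire (fun=> set0).
  by case: E0; exists x.
have [|x []] := H k s ws (leqnn k).
by rewrite take_oversize// ws.1.
Qed.

(** * Hulls of the children and the scales e_k *)

Variables (Ls Rs : nat -> R).
Hypothesis hleft : forall k s, words n k s -> gap n lo hi s 0 = Ls k.+1.
Hypothesis hright : forall k s, words n k s ->
  gap n lo hi s (n k.+1) = Rs k.+1.
Hypothesis hLs : forall k, (1 <= k)%N -> 0 <= Ls k.
Hypothesis hRs : forall k, (1 <= k)%N -> 0 <= Rs k.

(* The [d_k] and [e_k] of the header; [branches k] is [N_k]. *)
Local Definition hull k := delta k - Ls k.+1 - Rs k.+1.
Local Definition scale k := hull k / (n k.+1)%:R.

Lemma n_gt0 k : 0 < (n k.+1)%:R :> R.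
Proof. by rewrite ltr0n (leq_trans _ (hn _)). Qed.

Lemma lo_first k s : words n k s -> lo (rcons s 1%N) = lo s + Ls k.+1.
Proof. by move=> /hleft <-; rewrite /gap eqxx addrC subrK. Qed.

Lemma hi_last k s : words n k s -> hi (rcons s (n k.+1)) = hi s - Rs k.+1.
Proof.
move=> ws; rewrite -(hright ws) /gap ws.1 eqxx.
by case: eqP => [n0|_]; [have := @hn k.+1 isT; rewrite n0|rewrite subKr].
Qed.

Lemma child_in_hull k s i : words n k s -> (1 <= i <= n k.+1)%N ->
  lo s + Ls k.+1 <= lo (rcons s i) /\ hi (rcons s i) <= lo s + Ls k.+1 + hull k.
Proof.
move=> ws ik; have n2 := @hn k.+1 isT.
have len j : (1 <= j <= n k.+1)%N -> lo (rcons s j) <= hi (rcons s j).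
  by move=> jk; apply: lo_le_hi; exact: (words_rcons ws).
have hE : lo s + Ls k.+1 + hull k = hi (rcons s (n k.+1)).
  by rewrite (hi_last ws) /hull -(word_length ws); lra.
rewrite hE -(lo_first ws); split.
  have [->//|i1] : i = 1%N \/ (1 < i)%N by lia.
  apply: le_trans (len 1%N _) _; first lia.
  by apply: (child_le ws); lia.
have [->//|i1] : i = n k.+1 \/ (i < n k.+1)%N by lia.
apply: le_trans (len (n k.+1) _); last lia.
by apply: (child_le ws); lia.
Qed.

Lemma inner_gapE k s i : words n k s -> (1 <= i < n k.+1)%N ->
  gap n lo hi s i = lo (rcons s i.+1) - hi (rcons s i).
Proof.
move=> ws ik; rewrite /gap ws.1.
by have [-> ->] : (i == 0%N) = false /\ (i == n k.+1) = false by split; lia.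
Qed.

(** The children lie side by side in the hull; any word of level k will do, and [words_ones]
    supplies one. *)
Lemma hull_ge k : (n k.+1)%:R * delta k.+1 <= hull k.
Proof.
have ws := words_ones k; set s := nseq _ _ in ws.
have H j : (1 <= j <= n k.+1)%N ->
    j%:R * delta k.+1 <= hi (rcons s j) - lo (rcons s 1%N).
  elim: j => [|j IH] jn; first lia.
  have wj := words_rcons ws jn; have := word_length wj.
  have [->|j1] : j = 0%N \/ (1 <= j)%N by lia.
    by rewrite mul1r => ->.
  have := IH ltac:(lia); have := @child_le _ _ j j.+1 ws; rewrite -natr1 mulrDl.
  by move=> /(_ ltac:(lia) ltac:(lia)); lra.
have := H (n k.+1); rewrite (hi_last ws) (lo_first ws) leqnn andbT.
rewrite (leq_trans _ (hn _))// => /(_ isT) h.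
by apply: le_trans h _; rewrite /hull -(word_length ws); lra.
Qed.

(** The hull consists of n_{k+1} children and n_{k+1} - 1 gaps; one further [g] is added to get a
    product. *)
Lemma hull_le k (g : R) : 0 <= g ->
  (forall s i, words n k s -> (1 <= i < n k.+1)%N -> gap n lo hi s i <= g) ->
  hull k <= (n k.+1)%:R * (delta k.+1 + g).
Proof.
move=> g0 gapg; have ws := words_ones k; set s := nseq _ _ in ws.
have H j : (1 <= j <= n k.+1)%N ->
    hi (rcons s j) - lo (rcons s 1%N) <= j%:R * (delta k.+1 + g).
  elim: j => [|j IH] jn; first lia.
  have wj := words_rcons ws jn; have := word_length wj.
  have [->|j1] : j = 0%N \/ (1 <= j)%N by lia.
    by rewrite mul1r => ->; rewrite lerDl.
  have := IH ltac:(lia); have := gapg s j ws ltac:(lia).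
  rewrite (inner_gapE ws); last lia.
  by rewrite -[j.+1]addn1 natrD mulrDl mul1r; lra.
have := H (n k.+1); rewrite (hi_last ws) (lo_first ws) leqnn andbT.
rewrite (leq_trans _ (hn _))// => /(_ isT) h.
by apply: le_trans h; rewrite /hull -(word_length ws); lra.
Qed.

Lemma hull_gt0 k : 0 < hull k.
Proof.
by apply: lt_le_trans (hull_ge k); rewrite mulr_gt0 ?n_gt0// level_length_gt0.
Qed.

Lemma hull_le_level_length k : hull k <= delta k.
Proof. by have := hLs (ltn0Sn k); have := hRs (ltn0Sn k); rewrite /hull; lra. Qed.

Lemma scale_gt0 k : 0 < scale k.
Proof. by rewrite divr_gt0 ?hull_gt0 ?n_gt0. Qed.

Lemma scaleE k : scale k * (n k.+1)%:R = hull k.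
Proof. by rewrite divfK// gt_eqF// n_gt0. Qed.

Lemma hullS_le_scale k : hull k.+1 <= scale k.
Proof.
apply: le_trans (hull_le_level_length _) _.
by rewrite ler_pdivlMr ?n_gt0// mulrC hull_ge.
Qed.

Lemma scale_le_hull k : scale k <= hull k / 2.
Proof.
apply: ler_wpM2l; first exact/ltW/hull_gt0.
by rewrite lef_pV2 ?posrE ?n_gt0// (ler_nat _ 2) hn.
Qed.

Lemma hull_nonincreasing j k : (j <= k)%N -> hull k <= hull j.
Proof.
elim: k => [|k IH] jk; first by have -> : j = 0%N by lia.
have [->//|/IH jk'] : j = k.+1 \/ (j <= k)%N by lia.
have := hullS_le_scale k; have := scale_le_hull k; have := hull_gt0 k; lra.
Qed.

Lemma scale_lt k : scale k < (k.+1%:R)^-1.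
Proof.
apply: lt_le_trans (level_length_le k); have := scale_le_hull k.
have := hull_le_level_length k; have := hull_gt0 k; lra.
Qed.

Lemma scale_lt1 k : scale k < 1.
Proof.
by apply: lt_le_trans (scale_lt k) _; rewrite invf_le1 ?ler1n ?ltr0n.
Qed.

Lemma branches_scale k : (branches k.+1)%:R * scale k <= 1.
Proof.
rewrite branchesS natrM -mulrA [X in _ * X]mulrC scaleE.
apply: le_trans (branches_level_length k).
by apply: ler_wpM2l => //; exact: hull_le_level_length.
Qed.

(** * Upper bound for the covering numbers *)

Lemma covering_number_moran k q (e : R) : (0 < q)%N -> 0 < e ->
  hull k <= q%:R * e ->
  (covering_number (moran_set n lo hi) e <= (branches k * q)%:R%:E)%E.
Proof.
move=> q0 e0 hq.
pose l := [seq lo w + Ls k.+1 + j%:R * e | w <- extensions n [::] k,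
                                           j <- iota 0 q].
have -> : (branches k * q)%N = size l.
  rewrite size_allpairs size_iota; congr (_ * _)%N.
  by have := size_extensions n [::] k; rewrite big_geq// mul1n.
(* Locating [x] at level k + 1 puts it in the hull of the children of [w], not merely in the
   interval of [w]. *)
apply: covering_number_le => x /moran_setP - /(_ k.+1)[s [/words_rconsP]].
move=> [w [i [-> ww ik]]] /andP[x1 x2].
have [h1 h2] := child_in_hull ww ik.
pose z := x - (lo w + Ls k.+1).
have z0 : 0 <= z / e by apply: divr_ge0; [rewrite /z; lra|exact: ltW].
have ze : z / e <= q%:R by rewrite ler_pdivrMr// /z; lra.
have [j [jq j1 j2]] : exists j : nat,
    [/\ (j < q)%N, j%:R <= z / e & z / e <= j%:R + 1].
  have /andP[t1 t2] := truncn_itv z0.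
  (* A quotient [z / e] equal to [q] is assigned to the last piece. *)
  have [tq|qt] := ltnP (Num.truncn (z / e)) q.
    by exists (Num.truncn (z / e)); split => //; rewrite natr1 ltW.
  exists q.-1; split; first by rewrite prednK.
    by apply: le_trans t1; rewrite ler_nat (leq_trans _ qt)// leq_pred.
  by rewrite natr1 prednK.
exists (lo w + Ls k.+1 + j%:R * e).
  apply/allpairsP; exists (w, j); split => //=; first exact: words_extensions.
  by rewrite mem_iota add0n.
move: j1 j2; rewrite ler_pdivlMr// ler_pdivrMr// /z.
by move=> ? ?; apply/andP; split; lra.
Qed.

(** Let d_{k+1} <= e < d_k. If e < e_k, one interval per word of level k + 1 is enough. Otherwise
    the hulls of level k are cut, which takes at most 2 N_{k+1} e_k / e pieces; here N_{k+1} e_k <=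
    e^(1 - t), by the hypothesis and e_k <= e if t <= 1, and by N_{k+1} e_k <= 1 if t > 1. *)
Lemma covering_number_le_powR (t : R) k0 :
  (forall k, (k0 <= k)%N -> (branches k.+1)%:R <= scale k `^ (- t)) ->
  forall e, 0 < e -> e < hull k0 ->
  (covering_number (moran_set n lo hi) e <= (2 * e `^ (- t))%:E)%E.
Proof.
move=> ub e e0 ek0.
have ex : exists k, hull k <= e.
  exists (Num.truncn e^-1).+1; apply: le_trans (hull_le_level_length _) _.
  apply: le_trans (level_length_le _) _.
  rewrite -[leRHS]invrK lef_pV2 ?posrE ?invr_gt0//.
  have := truncnS_gt e^-1; rewrite -[X in _ <= X]natr1; lra.
(* For t < 0 the hypothesis would put N_{k+1} >= 1 below 1. *)
have t0 : 0 <= t.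
  rewrite leNgt; apply/negP => tn; have := ub k0 (leqnn _); apply/negP.
  rewrite -ltNge; apply: (@lt_le_trans _ _ 1).
    rewrite powR_exp ?scale_gt0// -expR0 ltr_expR.
    rewrite nmulr_llt0 ?ln_lt0 ?scale_gt0 ?scale_lt1//.
    by rewrite oppr_gt0.
  by rewrite ler1n branches_gt0.
case: (ex_minnP ex) => k ke kmin.
have : (k0 < k)%N.
  by rewrite ltnNge; apply/negP => /hull_nonincreasing; lra.
(* The least level with hull at most [e] is renamed k + 1. *)
case: k => // k in ke kmin *; rewrite ltnS => kk0.
have ek : e < hull k.
  by rewrite ltNge; apply/negP => /kmin; rewrite ltnn.
have pow_mono x y : 0 < x -> x <= y -> y `^ (- t) <= x `^ (- t).
  move=> x0 xy; rewrite !powR_exp ?(lt_le_trans x0)// ler_expR !mulNr lerN2.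
  by rewrite ler_wpM2l// ler_ln ?posrE// (lt_le_trans x0).
have [es|se] := ltP e (scale k).
  have := @covering_number_moran k.+1 1%N e isT e0; rewrite mul1r muln1.
  move=> /(_ ke) h; apply: le_trans h _; rewrite lee_fin.
  apply: le_trans (ub k kk0) _; apply: le_trans (pow_mono _ _ e0 (ltW es)) _.
  by have := powR_ge0 e (- t); lra.
have he0 : 0 <= hull k / e by rewrite divr_ge0 ?ltW ?hull_gt0.
have he1 : 1 < hull k / e by rewrite ltr_pdivlMr// mul1r.
pose q := (Num.truncn (hull k / e)).+1.
have hq : hull k <= q%:R * e by rewrite -ler_pdivrMr// ltW// truncnS_gt.
(* Rounding up costs at most a factor 2 because d_k / e > 1. *)
have hq' : q%:R <= 2 * (hull k / e).
  by have /andP[h _] := truncn_itv he0; rewrite /q -natr1; lra.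
apply: le_trans (covering_number_moran _ e0 hq) _ => //; rewrite lee_fin natrM.
apply: (@le_trans _ _ ((branches k)%:R * (2 * (hull k / e)))).
  by rewrite ler_wpM2l.
rewrite mulrCA ler_pM2l// mulrA ler_pdivrMr//.
have -> : (branches k)%:R * hull k = (branches k.+1)%:R * scale k.
  by rewrite branchesS natrM -mulrA [X in _ = _ * X]mulrC scaleE.
have -> : e `^ (- t) * e = e `^ (1 - t).
  by rewrite -[X in _ * X]powRr1 ?ltW// -powRD ?(gt_eqF e0) ?implybT// addrC.
have [t1|t1] := leP t 1; last first.
  apply: le_trans (branches_scale k) _.
  have e1 : e <= 1.
    have := hull_le_level_length 0; rewrite level_length0.
    by have := hull_nonincreasing (leq0n k); lra.
  rewrite powR_exp// -[leLHS]expR0 ler_expR; apply: mulr_le0; first lra.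
  by rewrite ln_le0.
apply: (@le_trans _ _ (scale k `^ (1 - t))).
  rewrite addrC powRD ?(gt_eqF (scale_gt0 k)) ?implybT//.
  rewrite powRr1; last exact/ltW/scale_gt0.
  by rewrite ler_pM2r ?scale_gt0// ub.
by apply: ler_powRl => //; [lra|rewrite ltW// scale_gt0].
Qed.

(** * Inner gaps and the separation of intervals with even last letter *)

Lemma inner_gap_ge0 k s i : words n k s -> (1 <= i < n k.+1)%N ->
  0 <= gap n lo hi s i.
Proof.
by move=> ws ik; rewrite (inner_gapE ws)// subr_ge0; apply: (child_le ws); lia.
Qed.

Lemma inner_gap_le1 k s i : words n k s -> (1 <= i < n k.+1)%N ->
  gap n lo hi s i <= 1.
Proof.
move=> ws ik; rewrite (inner_gapE ws)//.
have [i1 i2] : (1 <= i <= n k.+1)%N /\ (1 <= i.+1 <= n k.+1)%N by lia.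
have [? _] := child_sub ws i1; have [_ ?] := child_sub ws i2.
have := lo_le_hi (words_rcons ws i1); have := lo_le_hi (words_rcons ws i2).
have := take_sub ws (leq0n k); rewrite take0; case: hmoran => _ [-> ->] _ _.
lra.
Qed.

Lemma min_gap_le k s i : words n k s -> (1 <= i < n k.+1)%N ->
  min_gap n lo hi k.+1 <= gap n lo hi s i.
Proof.
move=> ws ik; apply: ge_inf; last by exists s, i; split => //; lia.
exists 0 => _ [w [j [ww jk ->]]]; apply: (inner_gap_ge0 ww).
by move: jk; rewrite /=; lia.
Qed.

Lemma le_max_gap k s i : words n k s -> (1 <= i < n k.+1)%N ->
  gap n lo hi s i <= max_gap n lo hi k.+1.
Proof.
move=> ws ik; apply: ub_le_sup; last by exists s, i; split => //; lia.
exists 1 => _ [w [j [ww jk ->]]]; apply: (inner_gap_le1 ww).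
by move: jk; rewrite /=; lia.
Qed.

Lemma min_gap_ge0 k : 0 <= min_gap n lo hi k.+1.
Proof.
have n2 := @hn k.+1 isT; apply: lb_le_inf.
  exists (gap n lo hi (nseq k 1%N) 1), (nseq k 1%N), 1%N.
  by split => //; [exact: words_ones|lia].
move=> _ [w [j [ww jk ->]]]; apply: (inner_gap_ge0 ww).
by move: jk; rewrite /=; lia.
Qed.

(** Even letters leave room for a whole interval of level k + 1 and an adjacent inner gap in
    between: the child after [i.*2] under a common parent, the first child of [w] otherwise. *)
Lemma separated_lt k s w i j x y : words n k s -> words n k w ->
  (1 <= i)%N -> (i.*2 <= n k.+1)%N -> (1 <= j)%N -> (j.*2 <= n k.+1)%N ->
  (s = w /\ (i < j)%N) \/ hi s <= lo w ->
  x <= hi (rcons s i.*2) -> lo (rcons w j.*2) <= y ->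
  x + (delta k.+1 + min_gap n lo hi k.+1) <= y.
Proof.
move=> ws ww i1 i2 j1 j2 ij xi yj.
have sep u l m : words n k u -> (1 <= l)%N -> (l.+1 < m)%N -> (m <= n k.+1)%N ->
    hi (rcons u l) + delta k.+1 + min_gap n lo hi k.+1 <= lo (rcons u m).
  move=> wu l1 lm mn.
  have l1n : (1 <= l.+1 <= n k.+1)%N by lia.
  have lkn : (1 <= l < n k.+1)%N by lia.
  have := word_length (words_rcons wu l1n); have := min_gap_le wu lkn.
  rewrite (inner_gapE wu)//.
  have := @child_le k u l.+1 m wu; move=> /(_ ltac:(lia) ltac:(lia)); lra.
case: ij => [[sw ij]|sw].
  subst w; have := @sep s i.*2 j.*2 ws.
  by move=> /(_ ltac:(lia) ltac:(lia) ltac:(lia)); lra.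
have i2n : (1 <= i.*2 <= n k.+1)%N by lia.
have n1 : (1 <= 1 <= n k.+1)%N by lia.
have n1' : (1 <= 1 < n k.+1)%N by lia.
have [_ hs] := child_sub ws i2n; have [lw _] := child_sub ww n1.
have := word_length (words_rcons ww n1); have := min_gap_le ww n1'.
rewrite (inner_gapE ww)// => h1 h2.
have lw2 : lo (rcons w 2%N) <= lo (rcons w j.*2).
  have [->//|j12] : j = 1%N \/ (2 < j.*2)%N by lia.
  apply: (@le_trans _ _ (hi (rcons w 2%N))).
    by apply: (@lo_le_hi k.+1); apply: words_rcons => //; lia.
  by apply: (child_le ww); lia.
lra.
Qed.

Lemma separated k s w i j x y : words n k s -> words n k w ->
  (1 <= i)%N -> (i.*2 <= n k.+1)%N -> (1 <= j)%N -> (j.*2 <= n k.+1)%N ->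
  rcons s i.*2 != rcons w j.*2 ->
  lo (rcons s i.*2) <= x <= hi (rcons s i.*2) ->
  lo (rcons w j.*2) <= y <= hi (rcons w j.*2) ->
  delta k.+1 + min_gap n lo hi k.+1 <= `|x - y|.
Proof.
move=> ws ww i1 i2 j1 j2 swij /andP[x1 x2] /andP[y1 y2].
have half : x + (delta k.+1 + min_gap n lo hi k.+1) <= y \/
            y + (delta k.+1 + min_gap n lo hi k.+1) <= x.
  have [sw|/(word_disjoint ws ww)[h|h]] := eqVneq s w.
  - have [ij|ji|ij] := ltngtP i j.
    + by left; apply: (separated_lt ws ww i1 i2 j1 j2) => //; left.
    + by right; apply: (separated_lt ww ws j1 j2 i1 i2) => //; left.
    + by move: swij; rewrite sw ij eqxx.
  - by left; apply: (separated_lt ws ww i1 i2 j1 j2) => //; right.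
  - by right; apply: (separated_lt ww ws j1 j2 i1 i2) => //; right.
by case: half => h; [rewrite distrC|]; apply: le_trans (ler_norm _); lra.
Qed.

(** * Packings at the scales e_k *)

Variables (w1 w2 w3 : R).
Hypotheses (hw1 : 0 < w1) (hw2 : 0 < w2) (hw3 : 0 < w3).
Hypothesis hABC : forall k, (1 <= k)%N ->
  [\/ max_gap n lo hi k <= w1 * delta k,
      max_gap n lo hi k <= w2 * min_gap n lo hi k
    | w3 * delta k.-1 <= (n k)%:R * min_gap n lo hi k].

(** Dominates the constants [1 + w1], [1 + w2] and [w3^-1] that (A), (B) and (C) yield
    separately. *)
Local Definition ratio := 1 + w1 + w2 + w3^-1.

Lemma ratio_gt0 : 0 < ratio.
Proof. by rewrite /ratio !addr_gt0 ?invr_gt0. Qed.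

(** Always e_k is at most delta_{k+1} plus the greatest gap, which (A) compares with delta_{k+1} and
    (B) with the least gap. Under (C), e_k <= delta_k / n_{k+1}, which is at most the least gap over
    [w3]. *)
Lemma scale_le_separation k :
  scale k <= ratio * (delta k.+1 + min_gap n lo hi k.+1).
Proof.
have d0 := level_length_gt0 k.+1; have m0 := min_gap_ge0 k.
have v0 : 0 < w3^-1 by rewrite invr_gt0.
have max_bnd : scale k <= delta k.+1 + max_gap n lo hi k.+1.
  rewrite ler_pdivrMr ?n_gt0// mulrC; apply: hull_le; last exact: le_max_gap.
  have n1 : (1 <= 1 < n k.+1)%N by have := @hn k.+1 isT; lia.
  apply: le_trans (le_max_gap (words_ones k) n1).
  exact: (inner_gap_ge0 (words_ones k)).
have bnd u : u <= ratio -> scale k <= u * (delta k.+1 + min_gap n lo hi k.+1) ->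
    scale k <= ratio * (delta k.+1 + min_gap n lo hi k.+1).
  move=> ur h; apply: le_trans h _; apply: ler_wpM2r => //.
  by rewrite addr_ge0// ltW.
case: (hABC (ltn0Sn k)) => [h|h|/= h].
- apply: (bnd (1 + w1)); first by rewrite /ratio -addrA lerDl addr_ge0// ltW.
  apply: le_trans max_bnd _; rewrite mulrDr mulrDl mul1r.
  by have := mulr_ge0 (ltW hw1) m0; lra.
- apply: (bnd (1 + w2)).
    have -> : ratio = 1 + w2 + (w1 + w3^-1) by rewrite /ratio; ring.
    by rewrite lerDl addr_ge0// ltW.
  apply: le_trans max_bnd _; rewrite mulrDr !mulrDl !mul1r.
  by have := mulr_ge0 (ltW hw2) (ltW d0); lra.
apply: (bnd w3^-1); first by rewrite /ratio lerDr !addr_ge0// ltW.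
rewrite mulrDr; apply: (@le_trans _ _ (w3^-1 * min_gap n lo hi k.+1)); last first.
  by rewrite lerDr mulr_ge0// ltW.
rewrite ler_pdivrMr ?n_gt0// mulrAC -mulrA mulrC ler_pdivlMr// mulrC.
apply: le_trans h; rewrite ler_pM2l//; exact: hull_le_level_length.
Qed.

(* The points of [F] in the intervals of the words below [s] with an even last
   letter are the centres of packings of unbounded weight. *)
Lemma packing_premeasure_moran m s (F : set R) (t eta : R) :
  words n m s ->
  (forall p w, words n p w -> (m <= p)%N -> take m w = s ->
     exists2 x, F x & lo w <= x <= hi w) ->
  0 <= t -> 0 < eta ->
  (forall k0, exists2 k, (k0 <= k)%N &
     scale k `^ (- (t + eta)) < (branches k.+1)%:R) ->
  packing_premeasure t F = +oo%E.
Proof.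
move=> ws HF t0 eta0 freq; apply/eqP; rewrite -leye_eq.
apply: le_packing_premeasure => d d0; rewrite leye_eq; apply/eqP/eq_infty => r.
have K0 := ratio_gt0.
(* The packing built below has weight at least C N_{k+1} e_k^t: the numerator comes from the radius,
   the denominator from the number of balls. *)
pose C := (2 * ratio)^-1 `^ t / (3 * branches m)%:R.
have C0 : 0 < C.
  rewrite divr_gt0// ?powR_gt0 ?invr_gt0 ?mulr_gt0//.
  by rewrite ltr0n muln_gt0 branches_gt0.
pose r' := `|r| + 1; have r'0 : 0 < r' by rewrite ltr_wpDl.
have rC0 : 0 < r' / C by exact: divr_gt0.
(* The first bound makes C e_k^(- eta) at least [r'], the second makes the radius at most [d]. *)
pose theta := Num.min (expR (- ln (r' / C) / eta)) (d * (4 * ratio)).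
have theta0 : 0 < theta by rewrite lt_min expR_gt0 !mulr_gt0.
have [k kk hk] := freq (maxn m (Num.truncn theta^-1)).
have [mk tk] : (m <= k)%N /\ (Num.truncn theta^-1 <= k)%N.
  by move: kk; rewrite geq_max => /andP.
have kth : scale k < theta.
  apply: lt_le_trans (scale_lt k) _.
  rewrite -[leRHS]invrK lef_pV2 ?posrE ?invr_gt0//.
  by apply: le_trans (ltW (truncnS_gt _)) _; rewrite ler_nat.
move: kth; rewrite lt_min => /andP[kth kd].
have e0 := scale_gt0 k; set e := scale k in kth kd e0 hk *.
pose l := [seq rcons w i.*2 | w <- extensions n s (k - m),
                              i <- iota 1 (n k.+1)./2].
have sm : size s = m := ws.1.
have ul : uniq l.
  apply: allpairs_uniq; [exact: extensions_uniq|exact: iota_uniq|].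
  move=> [w i] [w' i'] _ _ /= /rcons_inj[-> ii]; congr pair.
  exact: double_inj.
have lP v : v \in l -> exists w i, [/\ v = rcons w i.*2, words n k w,
    take m w = s, (1 <= i)%N & (i.*2 <= n k.+1)%N].
  case/allpairsP => -[w i] /= [/(extensionsP ws)[ww tw] ii ->].
  rewrite subnKC// in ww; exists w, i; move: ii; rewrite mem_iota add1n ltnS.
  case/andP=> i1 i2; split => //; rewrite -(odd_double_half (n k.+1)).
  by rewrite (leq_trans _ (leq_addl _ _))// leq_double.
have [pt ptP] : {pt : seq nat -> R & forall v, v \in l ->
    F (pt v) /\ lo v <= pt v <= hi v}.
  apply: (@choice _ _ (fun v (x : R) => v \in l -> F x /\ lo v <= x <= hi v)).
  move=> v; have [vl|nvl] := boolP (v \in l); last by exists 0.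
  have [w [i [vE ww tw i1 i2]]] := lP v vl.
  have wv : words n k.+1 v.
    by rewrite vE; apply: words_rcons => //; rewrite double_gt0 i1.
  have [|x Fx xv] := HF k.+1 v wv (leq_trans mk (leqnSn _)); last by exists x.
  by rewrite vE (take_rcons_words _ ww).
(* Two radii add up to half of the separation bound [e / ratio], so the balls are strictly apart. *)
pose rho := e / (4 * ratio).
have rho0 : 0 < rho by rewrite divr_gt0// mulr_gt0.
apply: le_trans (@sum_le_packing_delta _ t F d (size l)
  (fun i => pt (nth [::] l i)) (fun=> rho) _ _); last 2 first.
- move=> i il; have [Fv _] := ptP _ (mem_nth [::] il); split => //.
  by rewrite rho0 ler_pdivrMr ?mulr_gt0// ltW.
- move=> i j il jl ij.
  have vi := mem_nth [::] il; have vj := mem_nth [::] jl.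
  have : nth [::] l i != nth [::] l j by rewrite nth_uniq.
  have [_] := ptP _ vi; have [_] := ptP _ vj.
  have [w [a [-> ww _ a1 a2]]] := lP _ vi.
  have [w' [b [-> ww' _ b1 b2]]] := lP _ vj.
  move=> pj pi ne; apply: lt_le_trans (separated ww ww' a1 a2 b1 b2 ne pi pj).
  have := scale_le_separation k; rewrite mulrC -ler_pdivrMr// -/e.
  apply: lt_le_trans.
  have -> : rho + rho = e / ratio / 2.
    by rewrite /rho; field; rewrite gt_eqF.
  by have : 0 < e / ratio; [exact: divr_gt0|lra].
rewrite lee_fin big_const_ord iter_addr_0 -[leRHS]mulr_natr.
(* The 3 comes from n <= 3 floor(n / 2) for n >= 2, with equality at n = 3. *)
have card : (branches k.+1 <= 3 * branches m * size l)%N.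
  rewrite size_allpairs size_iota branchesS.
  have := size_extensions n s (k - m); rewrite sm subnKC//.
  rewrite -/(branches m) -/(branches k) => <-.
  have h3 : (n k.+1 <= 3 * (n k.+1)./2)%N.
    by have := @hn k.+1 isT; move: (n k.+1) => N N2; clear -N2; lia.
  set z := size _; have -> : (3 * branches m * (z * (n k.+1)./2) =
    branches m * z * (3 * (n k.+1)./2))%N by ring.
  by rewrite leq_mul2l h3 orbT.
have pw : (2 * rho) `^ t = (2 * ratio)^-1 `^ t * e `^ t.
  have i0 : 0 <= (2 * ratio)^-1 by rewrite invr_ge0 mulr_ge0// ltW.
  rewrite -(powRM _ i0 (ltW e0)); congr (_ `^ _).
  by rewrite /rho; field; rewrite gt_eqF.
apply: (@le_trans _ _ (C * e `^ (- eta))).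
  apply: (@le_trans _ _ r'); first by rewrite (le_trans (ler_norm r))// lerDl.
  rewrite mulrC -(ler_pdivrMr _ _ C0) -[leLHS]lnK ?posrE//.
  rewrite powR_exp// ler_expR mulNr lerNr.
  move: kth; rewrite -[X in X < _]lnK ?posrE// ltr_expR ltr_pdivlMr//.
  by rewrite mulrC => /ltW.
have -> : e `^ (- eta) = e `^ (- (t + eta)) * e `^ t.
  by rewrite -powRD ?(gt_eqF e0) ?implybT//; congr (_ `^ _); ring.
rewrite pw /C -!mulrA; apply: ler_wpM2l; first exact: powR_ge0.
rewrite mulrA [leRHS]mulrC; apply: ler_wpM2r; first exact: powR_ge0.
rewrite mulrC ler_pdivrMr; last by rewrite ltr0n muln_gt0 branches_gt0.
by apply: le_trans (ltW hk) _; rewrite -natrM ler_nat mulnC.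
Qed.

(** * The exponents and the two bounds by their upper limit *)

Local Definition exponent k :=
  ln (branches k.+1)%:R / (- ln (hull k) + ln (n k.+1)%:R).

Lemma exponentE k : exponent k = ln (branches k.+1)%:R / (- ln (scale k)).
Proof.
rewrite /exponent /scale ln_div ?posrE ?hull_gt0 ?n_gt0//.
by rewrite opprB addrC.
Qed.

Lemma Nln_scale_gt0 k : 0 < - ln (scale k).
Proof. by rewrite oppr_gt0 ln_lt0// scale_gt0 scale_lt1. Qed.

Lemma exponent_lt k (t : R) :
  (exponent k < t) = ((branches k.+1)%:R < scale k `^ (- t)).
Proof.
have B0 : 0 < (branches k.+1)%:R :> R by rewrite ltr0n branches_gt0.
rewrite exponentE ltr_pdivrMr ?Nln_scale_gt0//.
by rewrite -[RHS]ltr_ln ?posrE ?powR_gt0 ?scale_gt0// ln_powR mulrN mulNr.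
Qed.

Lemma lt_exponent k (t : R) :
  (t < exponent k) = (scale k `^ (- t) < (branches k.+1)%:R).
Proof.
have B0 : 0 < (branches k.+1)%:R :> R by rewrite ltr0n branches_gt0.
rewrite exponentE ltr_pdivlMr ?Nln_scale_gt0//.
by rewrite -[RHS]ltr_ln ?posrE ?powR_gt0 ?scale_gt0// ln_powR mulrN mulNr.
Qed.

(** A real [t] above the upper limit gives N_{k+1} < e_k^(- t) at all large levels, as the covering
    estimate requires. *)
Lemma upper_box_dim_moran_le :
  (upper_box_dim (moran_set n lo hi) <=
   limn_esup (fun k => (exponent k)%:E))%E.
Proof.
apply: lee_gt_fin => t /limf_esup_lt[V [k0 _ Vk0] Vt].
apply: (@upper_box_dim_le _ _ _ 2 (hull k0)) => //; first exact: hull_gt0.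
apply: covering_number_le_powR => k kk0; apply: ltW.
by rewrite -exponent_lt -lte_fin; apply: Vt; exact: Vk0.
Qed.

(** Below the upper limit, with margin [eta], infinitely many levels have N_{k+1} > e_k^(- t - eta);
    they give the packings in the member of the cover that [moran_baire] selects. *)
Lemma packing_dim_moran_ge :
  (limn_esup (fun k => (exponent k)%:E) <=
   packing_dim (moran_set n lo hi))%E.
Proof.
apply: le_packing_dim => t t0 /lte_fin_margin[eta eta0 tS].
apply: packing_measure_neq0 => F /moran_baire[i [m [s [ws HF]]]].
exists i; apply: (packing_premeasure_moran ws HF t0 eta0) => k0.
have [|k /= kk0 tk] := lt_limf_esup (V := [set k | (k0 <= k)%N]) tS.
  by exists k0.
by exists k => //; rewrite -lt_exponent -lte_fin.
Qed.

End Moran.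

Theorem theorem1 (R : realType)
  (n : nat -> nat) (c : nat -> R)
  (hn : forall k : nat, (1 <= k)%N -> (2 <= n k)%N)
  (hc : forall k : nat, (1 <= k)%N -> 0 < c k)
  (hnc : forall k : nat, (1 <= k)%N -> (n k)%:R * c k < 1)
  (lo hi : seq nat -> R)
  (hmoran : homogeneous_moran_structure n c lo hi)
  (E : set R) (hE : E = moran_set n lo hi)
  (Ls Rs : nat -> R)
  (hLs : forall k : nat, (1 <= k)%N -> 0 <= Ls k)
  (hRs : forall k : nat, (1 <= k)%N -> 0 <= Rs k)
  (hleft : forall (k : nat) (s : seq nat), words n k s ->
     gap n lo hi s 0 = Ls k.+1)
  (hright : forall (k : nat) (s : seq nat), words n k s ->
     gap n lo hi s (n k.+1) = Rs k.+1)
  (w1 w2 w3 : R) (hw1 : 0 < w1) (hw2 : 0 < w2) (hw3 : 0 < w3)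
  (hABC : forall k : nat, (1 <= k)%N ->
     [\/ max_gap n lo hi k <= w1 * level_length c k,
         max_gap n lo hi k <= w2 * min_gap n lo hi k
       | w3 * level_length c k.-1 <= (n k)%:R * min_gap n lo hi k]) :
  packing_dim E = upper_box_dim E /\
  upper_box_dim E =
    limn_esup (fun k : nat =>
      (ln (\prod_(1 <= i < k.+2) n i)%:R /
       (- ln (level_length c k - Ls k.+1 - Rs k.+1) + ln (n k.+1)%:R))%:E).
Proof.
subst E.
have le_box := upper_box_dim_moran_le hn hc hnc hmoran hleft hright hLs hRs.
have ge_packing := packing_dim_moran_ge hn hc hnc hmoran hleft hright hLs hRs
  hw1 hw2 hw3 hABC.
have packing_box := packing_dim_le_upper_box_dim (moran_nonempty hn hmoran).
(* The three inequalities form a cycle: packing dimension, box dimension, upper limit, packing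
   dimension. *)
split; apply/eqP; rewrite eq_le.
  by rewrite packing_box (le_trans le_box).
by rewrite le_box (le_trans ge_packing).
Qed.
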